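(* The elements $D_{i}$ ($i>0$, $(i,10)=1$) are linearly independent over $\mathbb{Z}/2$. Consequently $pr$ induces a bijection from $N2/N1$ onto $W$.
   Context: All power series are in $\mathbb{Z}/2[[x]]$. Let $F=\sum_{n\ \mathrm{odd},\,n>0}x^{n^{2}}$, $G=F(x^{5})$, $D=\sum_{n>0,\ (n,10)=1}x^{n^{2}}$. For $k>0$, $(k,10)=1$, define $D_{1}=D$, $D_{3}=D^{8}/G$, $D_{7}=D^{2}G$, $D_{9}=D^{4}G$, $D_{k+10}=G^{2}D_{k}$; $W$ is the span of all $D_{k}$. $N2$ is the $\mathbb{Z}/2[G^{2}]$-submodule generated by $G,F,F^{2}G,F^{3},F^{4}G$, and $N1\subset N2$ is the $\mathbb{Z}/2[G^{2}]$-submodule generated by $G$. The map $pr:\mathbb{Z}/2[[x]]\to\mathbb{Z}/2[[x]]$ sends $\sum c_{n}x^{n}$ to $\sum_{(n,5)=1}c_{n}x^{n}$; it is $\mathbb{Z}/2[G]$-linear, kills $N1$, and maps $N2$ into $W$ (with $pr(F)=D_{1}$, $pr(F^{8}/G)=D_{3}$, $pr(F^{2}G)=D_{7}$, $pr(F^{4}G)=D_{9}$). *)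

(* Defs.v *)
(* Formal power series over Z/2 are represented as
   coefficient functions nat -> 'F_2 (equality = extensional equality of
   functions). *)
From mathcomp Require Import all_boot all_order all_algebra.
Set Implicit Arguments. Unset Strict Implicit. Unset Printing Implicit Defensive.
Import GRing.Theory.
Local Open Scope ring_scope.

Definition ps := nat -> 'F_2.

Definition ps0 : ps := fun _ => 0.
Definition ps1 : ps := fun n => (n == 0%N)%:R.
Definition psadd (f g : ps) : ps := fun n => f n + g n.
Definition psscale (c : 'F_2) (f : ps) : ps := fun n => c * f n.
Definition psmul (f g : ps) : ps :=
  fun n => \sum_(i < n.+1) f i * g (n - i)%N.
Definition pspow (f : ps) (k : nat) : ps := iter k (psmul f) ps1.

(* Exact division P / Q, where Q has valuation v and leading coefficient 1
   (the only nonzero element of Z/2): h_n = P_(n+v) - sum_(i<n) h_i Q_(n+v-i).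
   This is the unique series h with Q * h = P whenever such h exists. *)
Fixpoint divseq (v : nat) (P Q : ps) (n : nat) : seq 'F_2 :=
  match n with
  | 0%N => [:: P v]
  | n'.+1 => let s := divseq v P Q n' in
             rcons s (P (n + v)%N - \sum_(i < n) s`_i * Q (n + v - i)%N)
  end.
Definition psdiv (v : nat) (P Q : ps) : ps := fun n => (divseq v P Q n)`_n.

Definition psF : ps :=
  fun n => [exists m : 'I_n.+1, odd m && (m * m == n)%N]%:R.
Definition psG : ps := fun n => if (5 %| n)%N then psF (n %/ 5)%N else 0.
(* D = sum_{n>0, (n,10)=1} x^(n^2)  (coprime 0 10 is false, so n>0 is automatic) *)
Definition psD : ps :=
  fun n => [exists m : 'I_n.+1, coprime m 10 && (m * m == n)%N]%:R.

Definition Dbase (r : nat) : ps :=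
  match r with
  | 1%N => psD
  | 3%N => psdiv 5 (pspow psD 8) psG
  | 7%N => psmul (pspow psD 2) psG
  | 9%N => psmul (pspow psD 4) psG
  | _ => ps0
  end.
(* D_{k+10} = G^2 D_k, i.e. D_k = G^(2 (k div 10)) D_(k mod 10) *)
Definition Dk (k : nat) : ps := psmul (pspow psG (2 * (k %/ 10))) (Dbase (k %% 10)).

Definition Dcomb (n : nat) (c : nat -> 'F_2) : ps :=
  \big[psadd/ps0]_(k < n | coprime k 10) psscale (c k) (Dk k).

Definition inW (w : ps) : Prop := exists n c, w = Dcomb n c.

Definition N2gen (i : 'I_5) : ps :=
  match val i with
  | 0%N => psG
  | 1%N => psF
  | 2%N => psmul (pspow psF 2) psG
  | 3%N => pspow psF 3
  | _ => psmul (pspow psF 4) psG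
  end.

Definition inN2 (x : ps) : Prop :=
  exists (m : nat) (a : 'I_5 -> nat -> 'F_2),
    x = \big[psadd/ps0]_(j < m) \big[psadd/ps0]_(i < 5)
          psscale (a i j) (psmul (pspow psG (2 * j)) (N2gen i)).

Definition inN1 (x : ps) : Prop :=
  exists (m : nat) (a : nat -> 'F_2),
    x = \big[psadd/ps0]_(j < m) psscale (a j) (psmul (pspow psG (2 * j)) psG).

Definition pr (f : ps) : ps := fun n => if coprime n 5 then f n else 0.

(* Main.v *)
(** Since [D = x + ...] and [G = x^5 + ...], the series [D_k] has order exactly
    [k], whence linear independence.  The map [pr] is linear over series in
    [x^5], commutes with squaring, and sends [F] to [D]; the only generator of
    [N2] whose image is not immediate is [F^3], which requires the modular
    equation [(F^2 + G^2)^3 = F G].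

    With [H] the sum of the [x^(r^2)], [r > 0] prime to 6, that equation follows
    from [H H(x^2) = F(x^3)] and [H H(x^5) = F(x^6) + F(x^30)].  Modulo 2, both
    are parity statements on the representations [t^2 + (m - 1) s^2 = n] with
    [t] and [s] odd and [m = 3] or [m = 6]: fixing the sign of [t] by
    [t = s mod m], the representations with [3 | s] cancel in pairs under
    [t -> - t]; on the set of all representations, conjugation in
    [Z[sqrt(1 - m)]] after division by [1 + sqrt(1 - m)] is an involution whose
    fixed points are counted by the right-hand side. *)
Require Import Defs.
From HB Require Import structures.
From mathcomp Require Import all_boot all_order all_algebra.
From mathcomp Require Import boolp ring zify.
Set Implicit Arguments. Unset Strict Implicit. Unset Printing Implicit Defensive.
Import GRing.Theory Num.Theory.
Local Open Scope ring_scope.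

(** * The ring of power series over [Z/2] *)

Definition psopp (f : ps) : ps := fun n => - f n.

(** Coefficients below [N] depend only on truncations, so the ring laws for series reduce to those
    for polynomials. *)
Lemma psmulE (f g : ps) (N n : nat) : (n < N)%N ->
  psmul f g n = (\poly_(i < N) f i * \poly_(i < N) g i)`_n.
Proof.
move=> ltnN; rewrite coefM; apply: eq_bigr => -[i lti] _ /=.
by rewrite !coef_poly !ifT //; lia.
Qed.

Lemma psmulA : associative psmul.
Proof.
move=> f g h; apply: funext => n.
pose p (f : ps) := \poly_(i < n.+1) f i.
transitivity ((p f * (p g * p h))`_n).
  rewrite coefM; apply: eq_bigr => -[i lti] _ /=.
  by rewrite coef_poly lti (@psmulE _ _ n.+1) //; lia.
rewrite mulrA coefM; apply: eq_bigr => -[i lti] _ /=.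
by rewrite (@psmulE _ _ n.+1) // [(p h)`_ _]coef_poly ifT //; lia.
Qed.

Lemma psmulC : commutative psmul.
Proof. by move=> f g; apply: funext => n; rewrite !(@psmulE _ _ n.+1) // mulrC. Qed.

Lemma psmul1 : left_id ps1 psmul.
Proof.
move=> f; apply: funext => n; rewrite /psmul big_ord_recl big1 => [|i _].
  by rewrite addr0 mul1r subn0.
by rewrite mul0r.
Qed.

Lemma psmulDl : left_distributive psmul psadd.
Proof.
move=> f g h; apply: funext => n; rewrite /psmul /psadd -big_split /=.
by apply: eq_bigr => i _; rewrite mulrDl.
Qed.

Lemma psaddA : associative psadd.
Proof. by move=> f g h; apply: funext => n; apply: addrA. Qed.

Lemma psaddC : commutative psadd.
Proof. by move=> f g; apply: funext => n; apply: addrC. Qed.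

Lemma psadd0 : left_id ps0 psadd.
Proof. by move=> f; apply: funext => n; apply: add0r. Qed.

Lemma psaddN : left_inverse ps0 psopp psadd.
Proof. by move=> f; apply: funext => n; apply: addNr. Qed.

HB.instance Definition _ := gen_eqMixin ps.
HB.instance Definition _ := gen_choiceMixin ps.
HB.instance Definition _ := GRing.isZmodule.Build ps psaddA psaddC psadd0 psaddN.

Lemma ps1_neq0 : ps1 != ps0.
Proof. by apply/eqP => /(congr1 (fun f : ps => f 0%N)). Qed.

HB.instance Definition _ := GRing.Zmodule_isComNzRing.Build ps
  psmulA psmulC psmul1 psmulDl ps1_neq0.

Lemma pspowE (f : ps) k : pspow f k = f ^+ k.
Proof. by elim: k => [|k IHk] //; rewrite exprS -IHk. Qed.

Lemma psaddrr (f : ps) : f + f = 0.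
Proof. by apply: funext => n; apply: addrr_pchar2; apply: pchar_Fp. Qed.

Lemma ps_pchar : 2 \in [pchar ps].
Proof. by apply/andP; split=> //; rewrite mulr2n psaddrr. Qed.

Lemma F2_pchar : 2 \in [pchar 'F_2].
Proof. exact: pchar_Fp. Qed.

Lemma F2_sqr (x : 'F_2) : x * x = x.
Proof. by apply/val_inj; case: x => [[|[|?]] ?]. Qed.

Lemma ps_coef_sum (I : Type) (r : seq I) (P : pred I) (f : I -> ps) n :
  (\sum_(i <- r | P i) f i) n = \sum_(i <- r | P i) f i n.
Proof. by elim/big_rec2: _ => // i x y _ <-. Qed.

(** Over $\mathbb{Z}/2$ the two members of a 2-cycle of [f] cancel, so only fixed points
    contribute. *)
Lemma sum_invol (T : eqType) (f : T -> T) (g : T -> 'F_2) (s : seq T) :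
  uniq s -> {in s, forall x, f x \in s} -> {in s, forall x, f (f x) = x} ->
  {in s, forall x, g (f x) = g x} ->
  \sum_(x <- s) g x = \sum_(x <- s | f x == x) g x.
Proof.
elim: {s}(size s) {-2}s (leqnn (size s)) => [|k IHk] s.
  by rewrite leqn0 => /nilP-> *; rewrite !big_nil.
case: s => [|x s] /=; first by rewrite !big_nil.
rewrite ltnS => les /andP[xs us] fs ff gf.
have [fx|nfx] := eqVneq (f x) x.
  rewrite !big_cons fx eqxx; congr (_ + _); apply: IHk => // y ys.
  - have: f y \in x :: s by apply: fs; rewrite inE ys orbT.
    rewrite inE => /orP[/eqP fyx|//].
    by move: (ff y); rewrite fyx fx inE ys orbT => /(_ isT) xy; rewrite xy ys in xs.
  - by apply: ff; rewrite inE ys orbT.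
  - by apply: gf; rewrite inE ys orbT.
(* Here [x] and [f x] form a 2-cycle; both are removed before induction. *)
have fxs: f x \in s by move: (fs x (mem_head _ _)); rewrite inE (negPf nfx).
rewrite !big_cons (negPf nfx) (perm_big _ (perm_to_rem fxs)) /=.
rewrite [RHS](perm_big _ (perm_to_rem fxs)) /= !big_cons.
rewrite (gf x) ?mem_head // (ff x) ?mem_head // eq_sym (negPf nfx).
rewrite addrA (addrr_pchar2 F2_pchar) add0r.
apply: IHk; rewrite ?rem_uniq //.
- by rewrite size_rem //; lia.
- move=> y; rewrite mem_rem_uniq // inE => /andP[/= yfx ys].
  have yxs : y \in x :: s by rewrite inE ys orbT.
  rewrite mem_rem_uniq // inE /=; apply/andP; split.
    apply: contra xs => /eqP e; move: (ff y yxs); rewrite e.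
    by rewrite (ff x) ?mem_head // => ->.
  move: (fs y yxs); rewrite inE => /orP[/eqP e|//].
  by move: (ff y yxs) yfx; rewrite e => ->; rewrite eqxx.
- by move=> y /mem_rem ys; apply: ff; rewrite inE ys orbT.
- by move=> y /mem_rem ys; apply: gf; rewrite inE ys orbT.
Qed.

(** * The substitution $x \mapsto x^k$ *)

Definition dil (k : nat) (f : ps) : ps :=
  fun n => if (k %| n)%N then f (n %/ k)%N else 0.

Lemma dilM k : (0 < k)%N -> {morph dil k : f g / f * g}.
Proof.
move=> k0 f g; apply: funext => n; rewrite /dil; case: ifPn => [/dvdnP[m ->]|ndv].
  rewrite mulnK // /GRing.mul /= /psmul.
  rewrite [RHS](bigID (fun i : 'I_ _ => (k %| i)%N)) /= [X in _ + X]big1; last first.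
    by move=> i /negPf->; rewrite mul0r.
  rewrite addr0 -(big_mkord (fun i => (k %| i)%N)
    (fun i => (if (k %| i)%N then f (i %/ k)%N else 0) *
     (if (k %| m * k - i)%N then g ((m * k - i) %/ k)%N else 0))).
  rewrite -(big_mkord xpredT (fun i => f i * g (m - i)%N)).
  rewrite [RHS]big_mkcond /=.
  (* Raising [l] by one adds [k] indices on the right, of which only the last is divisible by
     [k]. *)
  suff E l : (l <= m)%N ->
    \sum_(0 <= i < l.+1) f i * g (m - i)%N =
    \sum_(0 <= i < (l * k).+1) if (k %| i)%N then
      (if (k %| i)%N then f (i %/ k)%N else 0) *
      (if (k %| m * k - i)%N then g ((m * k - i) %/ k)%N else 0) else 0.
    by rewrite E.
  elim: l => [|l IHl] lm; first by
    rewrite mul0n !big_nat1 dvdn0 div0n !subn0 dvdn_mull // mulnK.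
  rewrite big_nat_recr //= IHl ?(ltnW lm) //.
  rewrite (@big_cat_nat _ _ _ (l * k).+1 0 (l.+1 * k).+1) //=; last by rewrite ltnS leq_mul.
  congr (_ + _); rewrite big_nat_recr /=; last by rewrite ltn_pmul2r.
  rewrite dvdn_mull // mulnK // -mulnBl dvdn_mull // mulnK // big_nat big1 ?add0r //.
  move=> i lti; case: ifP => // /dvdnP[q qe]; subst i.
  by case/andP: lti; rewrite !ltn_pmul2r //; lia.
rewrite /GRing.mul /= /psmul big1 // => i _.
case: ifP => dv; last by rewrite mul0r.
case: ifP => dv'; last by rewrite mulr0.
by case/negP: ndv; rewrite -(subnKC (leq_ord i)) dvdn_addr.
Qed.

Lemma dilD k : {morph dil k : f g / f + g}.
Proof.
move=> f g; apply: funext => n; rewrite /dil /GRing.add /= /psadd.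
by case: ifP; rewrite ?addr0.
Qed.

Lemma dil_inj k : (0 < k)%N -> injective (dil k).
Proof.
move=> k0 f g e; apply: funext => n.
by move/(congr1 (fun h : ps => h (n * k)%N)): e; rewrite /dil dvdn_mull // mulnK.
Qed.

Lemma dil_dil k l f : (0 < k)%N -> (0 < l)%N -> dil k (dil l f) = dil (k * l) f.
Proof.
move=> k0 l0; apply: funext => n; rewrite /dil.
case: (boolP (k %| n)%N) => [/dvdnP[m ->]|kn].
  by rewrite mulnK // [(m * k)%N]mulnC dvdn_pmul2l // divnMl.
by case: ifP => // /(dvdn_trans (dvdn_mulr l (dvdnn k))); rewrite (negPf kn).
Qed.

(** In the coefficient of $x^n$ the terms $i$ and $n - i$ cancel; only the middle term remains, for
    even $n$, and $c^2 = c$ in $\mathbb{Z}/2$. *)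
Lemma sqr_dil f : f ^+ 2 = dil 2 f.
Proof.
apply: funext => n; rewrite expr2 [LHS]/(psmul f f n) /psmul.
have sym : {in index_enum 'I_n.+1, forall i, f (rev_ord i) * f (n - rev_ord i)%N =
    f i * f (n - i)%N}.
  by move=> i _ /=; rewrite subSS subKn ?leq_ord // mulrC.
rewrite (sum_invol (index_enum_uniq _) _ _ sym); first last.
- by move=> i _; rewrite rev_ordK.
- by move=> i _; rewrite mem_index_enum.
rewrite /dil; case: ifP => [/dvdnP[m e]|n2]; last first.
  rewrite big1 // => i /eqP/(congr1 val)/= e; have := leq_ord i.
  by move=> ?; exfalso; move: n2; lia.
have lt : (m < n.+1)%N by lia.
rewrite (big_pred1 (Ordinal lt)) /=; last first.
  move=> i /=; rewrite -!val_eqE /=; by have := leq_ord i; lia.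
have -> : (n - m = m)%N by lia.
by rewrite e mulnK // F2_sqr.
Qed.

(** * Theta series and the modular equation *)

(** The series $\sum_{P(m)} x^{m^2}$; [psF] is [theta odd] by conversion. *)
Definition theta (P : pred nat) : ps :=
  fun n => [exists m : 'I_n.+1, P m && (m * m == n)%N]%:R.

(** At most one $m$ has $d m^2 = n$, so the existence test equals the count. The free bound [N] lets
    several sums share one range. *)
Lemma dil_theta (P : pred nat) d n N : (0 < d)%N -> (n < N)%N ->
  dil d (theta P) n = \sum_(m <- iota 0 N | P m && (d * (m * m) == n)%N) 1.
Proof.
move=> d0 nN; rewrite /dil; case: ifP => [/dvdnP[k e]|ndv]; last first.
  rewrite big1 // => m /andP[_ /eqP e].
  by move: ndv; rewrite -e dvdn_mulr.
rewrite {}e in nN *; rewrite mulnK // /theta.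
case: existsP => [[[m lm] /= /andP[Pm /eqP e]]|nex]; last first.
  rewrite big1_seq // => m /andP[/andP[Pm /eqP e] _]; case: nex.
  have e' : (m * m = k)%N.
    by apply/eqP; rewrite -(eqn_pmul2l d0) e mulnC.
  have lm : (m < k.+1)%N by rewrite ltnS -e'; case: (m) => // ?; rewrite leq_pmulr.
  by exists (Ordinal lm); rewrite /= Pm e' eqxx.
rewrite big_mkcond (bigD1_seq m) ?iota_uniq //=; last first.
  by rewrite mem_iota /=; nia.
rewrite Pm e mulnC eqxx /= big1 ?addr0 // => j /negPf jm.
case: ifP => // /andP[_]; rewrite mulnC eqn_pmul2r // -e => /eqP ejm.
by move: jm; rewrite -(eqn_sqr j m) -!mulnn ejm eqxx.
Qed.

Lemma theta_mul (P : pred nat) d n : (0 < d)%N ->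
  (theta P * dil d (theta P)) n =
  \sum_(p <- [seq (r, s) | r <- iota 0 n.+1, s <- iota 0 n.+1]
    | [&& P p.1, P p.2 & (p.1 * p.1 + d * (p.2 * p.2) == n)%N]) 1.
Proof.
move=> d0; rewrite [LHS]/(psmul _ _ n) /psmul [RHS]big_mkcond big_allpairs_dep /=.
transitivity (\sum_(i < n.+1) \sum_(r <- iota 0 n.+1) \sum_(s <- iota 0 n.+1)
   (if [&& P r, P s, (r * r == i)%N & (d * (s * s) == n - i)%N] then 1 else 0 : 'F_2)).
  apply: eq_bigr => -[i li] _ /=.
  have -> : theta P i = dil 1 (theta P) i by rewrite /dil dvd1n divn1.
  rewrite (@dil_theta _ _ _ n.+1) // (@dil_theta _ _ _ n.+1) //; last by lia.
  rewrite big_distrl /= big_mkcond /=; apply: eq_bigr => r _; rewrite mul1n.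
  case: (P r) => /=; last by rewrite big1.
  case: eqP => _ /=; last by rewrite big1 // => s _; rewrite andbF.
  by rewrite mul1r big_mkcond.
rewrite exchange_big /=; apply: eq_bigr => r _.
rewrite exchange_big /=; apply: eq_bigr => s _.
case: (P r) => /=; last by rewrite big1.
case: (P s) => /=; last by rewrite big1.
case: eqP => e.
  have lt : (r * r < n.+1)%N by lia.
  rewrite (bigD1 (Ordinal lt)) //= big1 ?addr0 => [|i ni].
    by rewrite eqxx /= ifT //; lia.
  rewrite ifF //; apply/andP => -[/eqP e' _]; case/eqP: ni.
  by apply: val_inj.
rewrite big1 // => i _; rewrite ifF //; apply/andP => -[/eqP e1 /eqP e2].
by have := leq_ord i; lia.
Qed.

Lemma eq_sum1 (T1 T2 : eqType) (f : T1 -> T2) (g : T2 -> T1) (s1 : seq T1) (s2 : seq T2) :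
  uniq s1 -> uniq s2 ->
  {in s1, forall x, f x \in s2 /\ g (f x) = x} ->
  {in s2, forall y, g y \in s1 /\ f (g y) = y} ->
  \sum_(x <- s1) 1 = \sum_(y <- s2) 1 :> 'F_2.
Proof.
move=> u1 u2 fP gP; rewrite -(big_map f xpredT (fun _ => 1)).
apply: perm_big; apply: uniq_perm => //.
  rewrite map_inj_in_uniq // => x y xs ys e.
  by rewrite -(fP x xs).2 e (fP y ys).2.
move=> y; apply/mapP/idP => [[x xs ->]|ys]; first exact: (fP x xs).1.
by exists (g y); [exact: (gP y ys).1 | rewrite (gP y ys).2].
Qed.

(** * Parity of the representations $t^2 + (m - 1) s^2 = n$ *)

Definition intbox (n : nat) : seq (int * int) :=
  let I := [seq i%:Z - n%:Z | i <- iota 0 n.*2.+1] in [seq (s, k) | s <- I, k <- I].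

Lemma intbox_uniq n : uniq (intbox n).
Proof.
have uI : uniq [seq i%:Z - n%:Z | i <- iota 0 n.*2.+1].
  by rewrite map_inj_uniq ?iota_uniq // => i j /addIr [].
by apply: allpairs_uniq => // -[a b] [c d].
Qed.

Lemma mem_intbox n (s k : int) : (`|s| <= n)%N -> (`|k| <= n)%N -> (s, k) \in intbox n.
Proof.
have mI (x : int) : (`|x| <= n)%N -> x \in [seq i%:Z - n%:Z | i <- iota 0 n.*2.+1].
  move=> xn; apply/mapP; exists ((absz (x + n%:Z))); last by lia.
  by rewrite mem_iota; lia.
by move=> sn kn; apply: (allpairs_f pair); apply: mI.
Qed.

(* The pair [(s, k)] stands for the representation [t^2 + (m - 1) s^2 = n]
   with [t = s + m k], i.e. for [t] and [s] congruent modulo [m]. *)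
Definition rep (m n : nat) (x : int * int) : bool :=
  [&& (0 < x.1)%R, odd (absz x.1), odd (absz (x.1 + m%:Z * x.2)) &
      m%:Z * (x.1 * x.1 + 2 * x.1 * x.2 + m%:Z * (x.2 * x.2)) == n%:Z].

(** The form is $m ((s + k)^2 + (m - 1) k^2)$, so $(s + k)^2 + k^2 \le n$, which bounds $|k|$ and
    $|s| \le |s + k| + |k|$ by $n$. *)
Lemma rep_box m n x : (1 < m)%N -> rep m n x -> x \in intbox n.
Proof.
case: x => s k m1 /and4P[/= _ _ _ /eqP e].
have sq (y : int) : (absz y)%:Z <= y * y by nia.
have e1 : m%:Z * ((s + k) * (s + k) + k * k + (m%:Z - 2) * (k * k)) = n%:Z.
  by rewrite -e; ring.
have B : (s + k) * (s + k) + k * k <= n%:Z.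
  have h1 := sq (s + k); have h2 := sq k.
  have : 0 <= (m%:Z - 2) * (k * k) by rewrite mulr_ge0 //; lia.
  set a := _ * (k * k) in e1 *; set c := k * k in e1 h2 *.
  set b := (s + k) * (s + k) in e1 h1 *; move: a b c e1 h1 h2 => a b c *; nia.
have := sq (s + k); have := sq k.
by move=> *; apply: mem_intbox; lia.
Qed.

Definition reps m n := [seq x <- intbox n | rep m n x].

Lemma mem_reps m n x : (1 < m)%N -> (x \in reps m n) = rep m n x.
Proof.
by move=> m1; rewrite mem_filter; case: (boolP (rep m n x)) => // /rep_box->.
Qed.

Lemma reps_uniq m n : uniq (reps m n).
Proof. by rewrite filter_uniq ?intbox_uniq. Qed.

(* With [t = u - (m - 1) v] and [s = u + v], one has [t^2 + (m - 1) s^2 = m (u^2 + (m - 1) v^2)];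
   this is the involution [v -> - v], followed by an overall sign change when [s] becomes negative. *)
Definition repconj (x : int * int) : int * int :=
  let s := x.1 + 2 * x.2 in if 0 < s then (s, - x.2) else (- s, x.2).

Lemma repconjK m n x : rep m n x -> repconj (repconj x) = x.
Proof.
case: x => s k /and4P[/= s0 os _ _]; rewrite /repconj /=.
by case h: (0 < s + 2 * k) => /=; case: ifP => /= h2; congr (_, _); lia.
Qed.

Lemma rep_conj m n x : m \in [:: 3; 6]%N -> rep m n x -> rep m n (repconj x).
Proof.
case: x => s k hm /and4P[/= s0 os ot /eqP e]; rewrite /repconj /=.
case: ifP => h; apply/and4P; split=> /=.
all: try by rewrite -e; apply/eqP; ring.
all: try lia.
all: by move: hm; rewrite !inE => /orP[] /eqP E; subst m; lia.
Qed.

(** By the sign of $s + 2k$, a fixed point has $k = 0$, so $t = s$ and $n = m s^2$, or $k = -s$, so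
    $t = -(m - 1) s$ and $n = m (m - 1) s^2$. *)
Lemma repconj_fix m n x : rep m n x ->
  (repconj x == x) = (x.2 == 0) || (x.2 == - x.1).
Proof.
case: x => s k /and4P[/= s0 os _ _]; rewrite /repconj /=.
by case: ifP => h; rewrite xpair_eqE; lia.
Qed.

Definition sqrep (P : pred nat) (d n : nat) : seq nat :=
  [seq a <- iota 0 n.+1 | P a && (d * (a * a) == n)%N].

Lemma mem_sqrep P d n a : (0 < d)%N ->
  (a \in sqrep P d n) = P a && (d * (a * a) == n)%N.
Proof.
move=> d0; rewrite mem_filter mem_iota; case: (P a) => //=.
by case: eqP => //= <-; nia.
Qed.

Lemma sqrep_uniq P d n : uniq (sqrep P d n).
Proof. by rewrite filter_uniq ?iota_uniq. Qed.

(** The right side counts the fixed points of [repconj]. In the family $k = -s$, $t = -(m - 1) s$ is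
    odd only for even $m$, whence [~~ odd m]. *)
Lemma sum_reps m n : m \in [:: 3; 6]%N ->
  \sum_(x <- reps m n) 1 = \sum_(a <- sqrep odd m n) 1
     + \sum_(a <- sqrep (fun a => odd a && ~~ odd m) (m * m.-1) n) 1 :> 'F_2.
Proof.
move=> hm; have m1 : (1 < m)%N by move: hm; rewrite !inE => /orP[] /eqP->.
rewrite (@sum_invol _ repconj) ?reps_uniq //; first last.
- by move=> x; rewrite mem_reps // => /repconjK.
- by move=> x; rewrite !mem_reps //; apply: rep_conj.
rewrite (bigID (fun x : int * int => x.2 == 0)) /= -big_filter -[X in _ + X]big_filter.
congr (_ + _).
  apply: (@eq_sum1 _ _ (fun x => absz x.1) (fun a => (a%:Z, 0)));
    rewrite ?sqrep_uniq ?(filter_uniq _ (reps_uniq _ _)) //.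
    move=> [s k]; rewrite mem_filter mem_reps // mem_sqrep ?(ltnW m1) //=.
    case/andP=> /andP[_ /eqP k0] /and4P[/= s0 os ot /eqP e]; subst k.
    by split; [rewrite os /=; nia | congr (_, _); lia].
  move=> a; rewrite mem_sqrep ?(ltnW m1) // => /andP[oa /eqP e].
  rewrite mem_filter mem_reps //=; split=> //.
  have R : rep m n (a%:Z, 0).
    by apply/and4P; split=> //=; rewrite ?mulr0 ?addr0 //; lia.
  by rewrite R (repconj_fix R).
apply: (@eq_sum1 _ _ (fun x => absz x.1) (fun a => (a%:Z, - a%:Z)));
    rewrite ?sqrep_uniq ?(filter_uniq _ (reps_uniq _ _)) //.
  move=> [s k]; rewrite mem_filter mem_reps // mem_sqrep ?muln_gt0 ?(ltnW m1) /=; last by lia.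
  case/andP=> /andP[fx /negPf k0] R; move: (fx); rewrite (repconj_fix R) /= k0 /=.
  move=> /eqP k1; subst k; case/and4P: R => /= s0 os ot /eqP e.
  have os' : odd (absz s) && ~~ odd m.
    by move: hm; rewrite !inE => /orP[] /eqP E; subst m; lia.
  split; last by congr (_, _); lia.
  rewrite os' /=; apply/eqP; clear fx k0 ot os'; case: s => // s in s0 os e *; rewrite -[n]/(absz n%:Z) -e.
  by move: hm; rewrite !inE => /orP[] /eqP E; subst m => /=; nia.
move=> a; rewrite mem_sqrep ?muln_gt0 ?(ltnW m1) //=; last by lia.
move=> /andP[/andP[oa om] /eqP e].
rewrite mem_filter mem_reps //=; split=> //.
have R : rep m n (a%:Z, - a%:Z).
  move: hm om e; rewrite !inE => /orP[] /eqP-> // _ e.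
  by apply/and4P; split=> //=; lia.
by rewrite R (repconj_fix R) /= eqxx orbT /= andbT; lia.
Qed.

(* On representations with [3 | s] (hence [3 | t]) the map [t -> - t] is a free involution. *)
Lemma sum_reps_dvd m n : m \in [:: 3; 6]%N ->
  \sum_(x <- reps m n | (3 %| absz x.1)%N) 1 = 0 :> 'F_2.
Proof.
move=> hm; have m1 : (1 < m)%N by move: hm; rewrite !inE => /orP[] /eqP->.
(* Keeping $s$ and negating $t = s + m k$ turns $k$ into $-k - 2s/m$; the quotient is exact since $3
   \mid s$ and $m$ is 3 or 6. *)
pose neg (x : int * int) : int * int := (x.1, - x.2 - (2 * x.1 %/ m%:Z)%Z).
have mem x : x \in [seq y <- reps m n | (3 %| absz y.1)%N] =
    (3 %| absz x.1)%N && rep m n x by rewrite mem_filter mem_reps.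
have km (s k : int) : (3 %| absz s)%N -> m%:Z * (2 * s %/ m%:Z)%Z = 2 * s.
  by move: hm; rewrite !inE => /orP[] /eqP->; lia.
rewrite -big_filter (@sum_invol _ neg) ?(filter_uniq _ (reps_uniq _ _)) //; first last.
- by move=> [s k] _; rewrite /neg /=; congr (_, _); lia.
- move=> [s k]; rewrite !mem => /andP[/= s3 /and4P[/= s0 os ot /eqP e]].
  have := km s k s3; set q := (_ %/ _)%Z => qe.
  rewrite s3 /=; apply/and4P; split=> //=.
    rewrite (_ : s + _ = - (s + m%:Z * k)) ?abszN //.
    by rewrite mulrBr qe; ring.
  rewrite -e; apply/eqP/eqP; rewrite -subr_eq0; apply/eqP.
  by transitivity ((m%:Z * q - 2 * s) * (m%:Z * q + 2 * m%:Z * k)); [ring | rewrite qe; ring].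
(* A fixed point would have $t = 0$, which is not odd. *)
rewrite big_filter_cond big1_seq // => -[s k] /andP[/andP[/= s3 /eqP[fk]]].
rewrite mem_reps // => /and4P[/= s0 os ot _].
have := km s k s3; move: fk; set q := (_ %/ _)%Z => qe1 qe2.
by move: hm ot; rewrite !inE => /orP[] /eqP E; subst m; lia.
Qed.

(** For $r, s$ prime to 6 exactly one choice of $t = \pm r$ is congruent to $s$ modulo $m$.
    Conversely $3 \mid m$ and $3 \nmid s$ give $3 \nmid t$, so $|t|$ and $s$ are prime to 6. *)
Lemma sum_reps_ndvd m n : m \in [:: 3; 6]%N ->
  \sum_(x <- reps m n | ~~ (3 %| absz x.1)%N) 1 =
  (theta (coprime 6) * dil m.-1 (theta (coprime 6))) n.
Proof.
move=> hm; have m1 : (1 < m)%N by move: hm; rewrite !inE => /orP[] /eqP->.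
have mem x : x \in [seq y <- reps m n | ~~ (3 %| absz y.1)%N] =
    ~~ (3 %| absz x.1)%N && rep m n x by rewrite mem_filter mem_reps.
have cop6 (a : nat) : coprime 6 a = odd a && ~~ (3 %| a)%N.
  by rewrite -[6%N]/(2 * 3)%N coprimeMl coprime2n prime_coprime.
(* Both $r$ and $s$ are $\pm 1$ modulo 6, so $m$ divides exactly one of $r - s$ and $r + s$. *)
have dvdm (r s : nat) : coprime 6 r -> coprime 6 s ->
    (m%:Z %| r%:Z - s%:Z)%Z = ~~ (m%:Z %| - r%:Z - s%:Z)%Z.
  rewrite !cop6; move=> /andP[or r3] /andP[os s3].
  have r6 : (r %% 6 = 1 \/ r %% 6 = 5)%N by lia.
  have s6 : (s %% 6 = 1 \/ s %% 6 = 5)%N by lia.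
  by move: hm; clear -r6 s6; rewrite !inE => /orP[] /eqP->; lia.
rewrite theta_mul; last by lia.
rewrite -[LHS]big_filter -[RHS]big_filter; symmetry.
pose t (p : nat * nat) : int :=
  if (m%:Z %| p.1%:Z - p.2%:Z)%Z then p.1%:Z else - p.1%:Z.
apply: (@eq_sum1 _ _ (fun p => (p.2%:Z, ((t p - p.2%:Z) %/ m%:Z)%Z))
   (fun x => (absz (x.1 + m%:Z * x.2), absz x.1))).
- rewrite filter_uniq // allpairs_uniq ?iota_uniq // => -[a b] [c d] //.
- exact: filter_uniq (reps_uniq _ _).
- move=> [r s]; rewrite mem mem_filter //= => /andP[/and3P[cr cs /eqP e] _].
  have dv : (m%:Z %| t (r, s) - s%:Z)%Z.
    by rewrite /t /=; case: ifP => //; rewrite dvdm // => /negbFE.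
  have ks : m%:Z * ((t (r, s) - s%:Z) %/ m%:Z)%Z = t (r, s) - s%:Z.
    by rewrite mulrC divzK.
  have tr : absz (t (r, s)) = r by rewrite /t /=; case: ifP; lia.
  have tt : t (r, s) * t (r, s) = (r * r)%N%:Z by rewrite /t /=; case: ifP => _; lia.
  move: ks tr tt; set k := (_ %/ _)%Z; move: (t _) => z ks tr tt.
  have sk : s%:Z + m%:Z * k = z by rewrite ks; ring.
  move: cr cs; rewrite !cop6 => /andP[or r3] /andP[os s3].
  rewrite sk tr; split=> //; rewrite s3 /=.
  apply/and4P; split=> /=; rewrite ?sk ?tr //; first by case: (s) os.
  rewrite -e PoszD -tt -sk; apply/eqP.
  rewrite PoszM PoszM (_ : (m.-1)%:Z = m%:Z - 1); last by lia.
  by ring.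
move=> [s k]; rewrite mem mem_filter => /andP[/= s3 /and4P[/= s0 os ot /eqP e]].
set z := s + m%:Z * k in ot *.
have [z3 zs] : ~~ (3 %| absz z)%N /\ (m%:Z %| z - s)%Z.
  split; last by rewrite /z addrC addKr dvdz_mulr.
  by rewrite /z; move: hm; rewrite !inE => /orP[] /eqP E; subst m; lia.
have cz : coprime 6 (absz z) by rewrite cop6 ot.
have cs : coprime 6 (absz s) by rewrite cop6 os.
have ss : (absz s)%:Z = s by lia.
have tz : t (absz z, absz s) = z.
  rewrite /t /= ss; have [z0|z0] := lerP 0 z.
    by rewrite (_ : (absz z)%:Z = z) ?zs //; lia.
  rewrite -[X in (_ %| _ - X)%Z]ss dvdm // ss.
  by rewrite (_ : - (absz z)%:Z = z) ?zs //; lia.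
have en : (absz z * absz z + m.-1 * (absz s * absz s))%N = n.
  apply/eqP; rewrite -eqz_nat PoszD !PoszM ss -e; apply/eqP.
  rewrite (_ : (m.-1)%:Z = m%:Z - 1); last by lia.
  rewrite (_ : (absz z)%:Z * (absz z)%:Z = z * z); last by clear; nia.
  by rewrite /z; ring.
have mz : (absz z, absz s) \in [seq (r, q) | r <- iota 0 n.+1, q <- iota 0 n.+1].
  have sq (a : nat) : (a <= a * a)%N by case: a => // a; rewrite leq_pmulr.
  apply: (allpairs_f pair); rewrite mem_iota /= add0n ltnS -en.
    exact: leq_trans (sq _) (leq_addr _ _).
  apply: leq_trans (sq _) (leq_trans _ (leq_addl _ _)).
  by rewrite leq_pmull //; lia.
rewrite mz andbT /= cz cs en eqxx tz ss; split=> //.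
by congr (_, _); rewrite /z addrC addKr mulKz //; lia.
Qed.

Lemma theta_coprime6_mul m : m \in [:: 3; 6]%N ->
  theta (coprime 6) * dil m.-1 (theta (coprime 6)) =
  dil m (theta odd) + dil (m * m.-1) (theta (fun a => odd a && ~~ odd m)).
Proof.
move=> hm; apply: funext => n; have m1 : (1 < m)%N by move: hm; rewrite !inE => /orP[] /eqP->.
rewrite -sum_reps_ndvd // [RHS]/(psadd _ _ n) /psadd.
rewrite !(@dil_theta _ _ n n.+1) ?muln_gt0 //; try lia.
rewrite -[X in X + _]big_filter -[X in _ + X]big_filter -sum_reps //.
by rewrite [RHS](bigID (fun x : int * int => (3 %| absz x.1)%N)) /= sum_reps_dvd ?add0r.
Qed.

(** * The modular equation between $F$ and $G$ *)

Lemma exprD_2X (f g : ps) k : (f + g) ^+ (2 ^ k) = f ^+ (2 ^ k) + g ^+ (2 ^ k).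
Proof. by apply: exprDn_pchar; rewrite (eq_pnat _ (pcharf_eq ps_pchar)) pnatX pnat_id. Qed.

Lemma psG_dil : psG = dil 5 psF.
Proof. by []. Qed.

(** Substituting $x^3$ for $x$ turns $F^2 + G^2$ into $H H(x^5)$. As $H^3 = H H(x^2) = F(x^3)$, its
    cube is $F(x^3) F(x^{15})$, which is $F G$ at $x^3$. *)
Lemma modular_equation : (psF ^+ 2 + psG ^+ 2) ^+ 3 = psF * psG.
Proof.
set H := theta (coprime 6).
have H3 : H ^+ 3 = dil 3 psF.
  rewrite exprS sqr_dil (@theta_coprime6_mul 3) //.
  (* For odd $m = 3$ the second theta series is empty. *)
  rewrite [X in _ + X](_ : _ = 0) ?addr0 //; apply: funext => n; rewrite /dil /theta.
  by case: ifP => // _; case: existsP => // -[i]; rewrite andbF.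
have H5 : H * dil 5 H = dil 3 (psF ^+ 2 + psG ^+ 2).
  rewrite (@theta_coprime6_mul 6) // psG_dil !sqr_dil dil_dil // dilD !dil_dil //.
  congr (_ + dil 30 _); apply: funext => n.
  by rewrite /theta; congr (_ %:R); congr nat_of_bool; apply: eq_existsb => i; rewrite andbT.
have dilX k f n : (0 < k)%N -> dil k (f ^+ n.+1) = dil k f ^+ n.+1.
  by move=> k0; elim: n => // n IHn; rewrite exprS dilM // IHn -exprS.
apply: (@dil_inj 3) => //; rewrite dilX // -H5 exprMn -dilX // H3 dilM //.
by rewrite psG_dil !dil_dil.
Qed.

(** The modular equation times $F^2 + G^2$; fourth powers are additive in characteristic 2. *)
Lemma modular_equation8 : psF ^+ 8 + psG ^+ 8 = psF * psG * (psF ^+ 2 + psG ^+ 2).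
Proof.
by rewrite -modular_equation -exprSr (exprD_2X _ _ 2) -!exprM.
Qed.

(** * Projection and leading terms *)

Lemma prD : {morph pr : f g / f + g}.
Proof.
move=> f g; apply: funext => n; rewrite /pr [RHS]/(psadd _ _ n) /psadd.
by case: ifP; rewrite ?addr0.
Qed.

Lemma pr0 : pr 0 = 0.
Proof. by apply: funext => n; rewrite /pr; case: ifP. Qed.

Lemma pr_sum (I : Type) (r : seq I) (P : pred I) (f : I -> ps) :
  pr (\sum_(i <- r | P i) f i) = \sum_(i <- r | P i) pr (f i).
Proof. exact: (big_morph pr prD pr0). Qed.

(** Shifting an exponent by a multiple of 5 does not change whether it is prime to 5. *)
Lemma pr_dilM f g : pr (dil 5 f * g) = dil 5 f * pr g.
Proof.
apply: funext => n; rewrite [RHS]/(psmul _ _ n) /psmul {1}/pr.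
rewrite [(dil 5 f * g) n]/(psmul _ _ n) /psmul.
transitivity (\sum_(i < n.+1) if coprime n 5 then dil 5 f i * g (n - i)%N else 0).
  by case: ifP => // _; rewrite big1.
apply: eq_bigr => -[i li] _ /=; rewrite /dil /pr.
case: (boolP (5 %| i)%N) => [i5|_]; last by rewrite !mul0r; case: ifP.
have -> : coprime (n - i) 5 = coprime n 5.
  by rewrite ![coprime _ 5]coprime_sym !prime_coprime // dvdn_subl //; lia.
by case: ifP; rewrite ?mulr0.
Qed.

Lemma pr_sqr f : pr (f ^+ 2) = pr f ^+ 2.
Proof.
apply: funext => n; rewrite !sqr_dil /pr /dil.
case: (boolP (2 %| n)%N) => [/dvdnP[m ->]|_]; last by case: ifP.
by rewrite mulnK // coprimeMl andbT.
Qed.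

Lemma pr_dil f : pr (dil 5 f) = 0.
Proof.
apply: funext => n; rewrite /pr /dil; case: ifP => // n5.
by rewrite ifN //; move: n5; rewrite coprime_sym prime_coprime.
Qed.

Lemma pr_psF : pr psF = psD.
Proof.
apply: funext => n; rewrite /pr /psF /psD.
have cop10 (a : nat) : coprime a 10 = odd a && coprime a 5.
  by rewrite -[10%N]/(2 * 5)%N coprimeMr coprimen2.
case: ifPn => cn.
  congr (_ %:R); congr nat_of_bool; apply: eq_existsb => i; rewrite cop10.
  case: eqP => // e; rewrite ?andbF ?andbT //; move: cn.
  by move: (congr1 (coprime^~ 5) e) => /= <-; rewrite coprimeMl => /andP[-> _]; rewrite andbT.
case: existsP => // -[i /andP[ci /eqP e]]; case/negP: cn.
move: ci; rewrite cop10 => /andP[_ ci].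
by move: (congr1 (coprime^~ 5) e) => /= <-; rewrite coprimeMl ci.
Qed.

(** * Orders of series and exact division *)

Definition lead (k : nat) (f : ps) : Prop := (forall i, (i < k)%N -> f i = 0) /\ f k = 1.

Lemma lead_mul k l f g : lead k f -> lead l g -> lead (k + l) (f * g).
Proof.
move=> [f0 f1] [g0 g1]; split=> [n lt|].
  rewrite [LHS]/(psmul _ _ n) /psmul big1 // => -[i li] _ /=.
  case: (ltnP i k) => ik; first by rewrite f0 ?mul0r.
  by rewrite g0 ?mulr0 //; lia.
rewrite [LHS]/(psmul _ _ _) /psmul.
have lk : (k < (k + l).+1)%N by lia.
rewrite (bigD1 (Ordinal lk)) //= addKn f1 g1 mulr1 big1 ?addr0 // => -[i li] /=.
rewrite -val_eqE /= => ik; case: (ltnP i k) => ik'; first by rewrite f0 ?mul0r.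
by rewrite g0 ?mulr0 //; lia.
Qed.

Lemma lead_exp k f n : lead k f -> lead (k * n) (f ^+ n).
Proof.
move=> lf; elim: n => [|n IHn]; first by rewrite muln0; split.
by rewrite exprS mulnS; apply: lead_mul.
Qed.

Lemma lead_add k l f g : (k < l)%N -> lead k f -> lead l g -> lead k (f + g).
Proof.
move=> kl [f0 f1] [g0 _]; rewrite [f + g]/(psadd f g) /psadd; split=> [i ik|].
  by rewrite f0 ?g0 ?addr0 //; lia.
by rewrite f1 g0 ?addr0.
Qed.

Lemma lead_pr k f : coprime k 5 -> lead k f -> lead k (pr f).
Proof.
move=> ck [f0 f1]; rewrite /pr; split=> [i ik|]; last by rewrite ck.
by rewrite f0 //; case: ifP.
Qed.

Lemma lead_psF : lead 1 psF.
Proof.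
split=> [[|//] _|]; rewrite /psF.
  by case: existsP => // -[[[|i] //]].
by case: existsP => // -[]; exists ord_max.
Qed.

Lemma lead_dil k l f : (0 < k)%N -> lead l f -> lead (k * l) (dil k f).
Proof.
move=> k0 [f0 f1]; rewrite /dil; split=> [i il|]; last by rewrite dvdn_mulr // mulKn.
case: ifP => // /dvdnP[q e]; rewrite {}e in il *; rewrite mulnK // f0 //.
by rewrite mulnC ltn_pmul2l in il.
Qed.

Lemma lead_psG : lead 5 psG.
Proof. exact: (@lead_dil 5 1 psF isT lead_psF). Qed.

Lemma lead_psD : lead 1 psD.
Proof. by rewrite -pr_psF; apply: lead_pr => //; apply: lead_psF. Qed.

(** As $Q = x^v + \dots$, the coefficient of $x^{n+v}$ in $Q h$ is $h_n$ plus terms in $h_i$ with $i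
    < n$; [divseq] solves this recursively. *)
Lemma psdivK v Q h : lead v Q -> psdiv v (psmul Q h) Q = h.
Proof.
move=> [Q0 Q1]; apply: funext => n; rewrite /psdiv.
have sumE k : psmul Q h (k + v)%N = \sum_(i < k) h i * Q (k + v - i)%N + h k.
  rewrite psmulC /psmul -(big_mkord xpredT (fun i => h i * Q (k + v - i)%N)).
  rewrite (@big_cat_nat _ _ _ k.+1) //=; last by lia.
  rewrite big_nat_recr //= big_mkord addKn Q1 mulr1 -[RHS]addr0; congr (_ + _).
  rewrite big_nat big1 //.
  by move=> i /andP[ki iv]; rewrite Q0 ?mulr0 //; lia.
suff -> : divseq v (psmul Q h) Q n = mkseq h n.+1 by rewrite nth_mkseq.
elim: n => [|n IHn]; first by rewrite /mkseq /= -[v in LHS]add0n sumE big_ord0 add0r.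
rewrite [LHS]/= IHn [RHS]mkseqS; congr rcons.
rewrite sumE addrAC -sumrB big1 ?add0r // => i _.
by rewrite nth_mkseq ?subrr // ltnS ltnW.
Qed.

(** Apply [pr] to $F^8 = G F^3 + G^3 F + G^8$: the left side becomes $D^8$, the term $G^8$ dies, and
    $G$ factors out of the rest. *)
Lemma psD3E : Dbase 3 = pr (psF ^+ 3) + psG ^+ 2 * psD.
Proof.
rewrite /Dbase pspowE; set h := _ + _.
suff -> : psD ^+ 8 = psmul psG h by apply: psdivK; apply: lead_psG.
rewrite -[psmul _ _]/(psG * h) /h mulrDr -pr_psF psG_dil -pr_dilM -psG_dil.
have -> : psG * (psG ^+ 2 * pr psF) = pr (psF * psG * psG ^+ 2).
  rewrite !expr2 -!mulrA [psF * _]mulrC psG_dil -!mulrA !pr_dilM.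
  by [].
have -> : pr psF ^+ 8 = pr (psF ^+ 8).
  by rewrite -[8%N]/(2 * (2 * 2))%N !exprM !pr_sqr.
have e8 : psF ^+ 8 = psG * psF ^+ 3 + psF * psG * psG ^+ 2 + psG ^+ 8.
  apply/eqP; rewrite -subr_eq; apply/eqP.
  rewrite (oppr_pchar2 ps_pchar) modular_equation8; ring.
have G8 : pr (psG ^+ 8) = 0.
  by rewrite -[8%N]/(2 * (2 * 2))%N !exprM !pr_sqr psG_dil pr_dil !expr0n.
by rewrite e8 !prD G8 addr0.
Qed.

(** * Independence of the [D_k] and the quotient [N2/N1] *)

Arguments pspow : simpl never.
Arguments Dbase : simpl never.

Lemma lead_psD3 : lead 3 (Dbase 3).
Proof.
(* The series $G^2 D$ has order $2 \cdot 5 + 1 = 11$. *)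
rewrite psD3E; apply: (@lead_add 3 11) => //.
  by apply: lead_pr => //; apply: (lead_exp 3 lead_psF).
exact: lead_mul (lead_exp 2 lead_psG) lead_psD.
Qed.

Lemma psD7E : Dbase 7 = psG * psD ^+ 2.
Proof. by rewrite /Dbase pspowE [LHS]psmulC. Qed.

Lemma psD9E : Dbase 9 = psG * psD ^+ 4.
Proof. by rewrite /Dbase pspowE [LHS]psmulC. Qed.

Lemma DkE k : Dk k = psG ^+ (2 * (k %/ 10)) * Dbase (k %% 10).
Proof. by rewrite /Dk pspowE. Qed.

(** The base series have orders 1, 3, $5 + 2$ and $5 + 4$, and each factor $G^2$ adds 10. *)
Lemma lead_Dk k : coprime k 10 -> lead k (Dk k).
Proof.
move=> ck; have lb : lead (k %% 10) (Dbase (k %% 10)).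
  move: ck; rewrite -coprime_modl; have := ltn_pmod k (isT : (0 < 10)%N).
  case: (k %% 10)%N => [|[|[|[|[|[|[|[|[|[|//]]]]]]]]]] // _ _.
  - exact: lead_psD.
  - exact: lead_psD3.
  - by rewrite psD7E; apply: (lead_mul lead_psG (lead_exp 2 lead_psD)).
  - by rewrite psD9E; apply: (lead_mul lead_psG (lead_exp 4 lead_psD)).
rewrite DkE; have := lead_mul (lead_exp (2 * (k %/ 10)) lead_psG) lb.
by rewrite mulnA mulnC -divn_eq.
Qed.

(** Scalars as constant series, so that linear combinations become ring expressions. *)
Definition psC (c : 'F_2) : ps := fun n => if n == 0%N then c else 0.

Lemma psscaleE c f : psscale c f = psC c * f.
Proof.
apply: funext => n; rewrite /psscale [RHS]/(psmul _ _ n) /psmul big_ord_recl big1 => [|i _].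
  by rewrite addr0 subn0.
by rewrite /psC /= mul0r.
Qed.

Lemma psCD : {morph psC : c d / c + d}.
Proof.
move=> c d; apply: funext => n; rewrite [RHS]/(psadd _ _ n) /psadd /psC.
by case: eqP; rewrite ?addr0.
Qed.

Lemma psC0 : psC 0 = 0.
Proof. by apply: funext => n; rewrite /psC; case: eqP. Qed.

Lemma dil_psC k c : dil k.+1 (psC c) = psC c.
Proof.
apply: funext => n; rewrite /dil /psC; case: n => [|n]; first by rewrite dvdn0.
by case: ifP => // /dvdnP[[|q] e] //; rewrite e mulnK.
Qed.

Lemma DcombE n c : Dcomb n c = \sum_(k < n | coprime k 10) psC (c k) * Dk k.
Proof. by rewrite /Dcomb; apply: eq_bigr => k _; rewrite psscaleE. Qed.

(** Strong induction on [k]: in the coefficient of $x^k$, terms with $i < k$ have [c i = 0], and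
    $D_i$ with $i > k$ has order above $k$. *)
Lemma Dk_free n c : Dcomb n c = 0 -> forall k, (k < n)%N -> coprime k 10 -> c k = 0.
Proof.
move=> e k; elim/ltn_ind: k => k IHk kn ck.
have := congr1 (fun f : ps => f k) e; rewrite DcombE ps_coef_sum.
have [d0 d1] := lead_Dk ck.
rewrite (bigD1 (Ordinal kn)) //= -psscaleE /psscale d1 mulr1 big1 ?addr0 // => i /andP[ci ik].
rewrite -psscaleE /psscale; case: (ltngtP i k) => [lt|gt|ei].
- by rewrite IHk ?mul0r.
- by have [z _] := lead_Dk ci; rewrite z ?mulr0.
- by case/eqP: ik; apply: val_inj.
Qed.

(** Grouping indices by tens presents $W$ as the $\mathbb{Z}/2[G^2]$-span of $D_1, D_3, D_7,
    D_9$. *)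
Lemma Dcomb10 M c :
  Dcomb (10 * M) c = \sum_(j < M) psG ^+ (2 * j) *
    (psC (c (10 * j + 1)%N) * psD + psC (c (10 * j + 3)%N) * Dbase 3 +
     psC (c (10 * j + 7)%N) * Dbase 7 + psC (c (10 * j + 9)%N) * Dbase 9).
Proof.
have DE j r : (r < 10)%N -> Dk (10 * j + r) = psG ^+ (2 * j) * Dbase r.
  by move=> r10; rewrite DkE (mulnC 10 j) divnMDl // divn_small // addn0 modnMDl modn_small.
have cE j r : coprime (10 * j + r) 10 = coprime r 10.
  by rewrite -coprime_modl mulnC modnMDl coprime_modl.
rewrite DcombE -(big_mkord (coprime^~ 10) (fun k => psC (c k) * Dk k)).
elim: M => [|M IHM]; first by rewrite muln0 big_geq // big_ord0.
rewrite big_ord_recr /= -IHM (@big_cat_nat _ _ _ (10 * M)) //=; last by lia.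
congr (_ + _); rewrite -{1}[(10 * M)%N]add0n big_addn mulnS addnK.
rewrite big_mkcond /= !big_nat_recl // big_geq //= ![(_ + 10 * M)%N]addnC !cE /=.
rewrite !add0r !addr0 !DE //.
change (Dbase 1) with psD; ring.
Qed.

(** * The map [pr] on $N2$ in coordinates *)

Definition N2comb (a : 'I_5 -> nat -> 'F_2) (m : nat) : ps :=
  \sum_(j < m) \sum_(i < 5) psC (a i j) * (psG ^+ (2 * j) * N2gen i).

Lemma inN2E x : inN2 x <-> exists m a, x = N2comb a m.
Proof.
by split=> -[m [a ->]]; exists m, a; apply: eq_bigr => j _; apply: eq_bigr => i _;
  rewrite psscaleE pspowE.
Qed.

Definition i5 k : 'I_5 := inord k.

(* The shift by one in the coefficient of [D_(10 j + 1)] comes from [pr (F^3) = D_3 + G^2 D_1]. *)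
Definition Dcoef (a : 'I_5 -> nat -> 'F_2) (k : nat) : 'F_2 :=
  let j := (k %/ 10)%N in
  match (k %% 10)%N with
  | 1 => a (i5 1) j + (if j is j'.+1 then a (i5 3) j' else 0)
  | 3 => a (i5 3) j
  | 7 => a (i5 2) j
  | 9 => a (i5 4) j
  | _ => 0
  end.

Lemma pr_psC c f : pr (psC c * f) = psC c * pr f.
Proof. by rewrite -(dil_psC 4 c) pr_dilM. Qed.

Lemma psG_exp_dil n : psG ^+ n = dil 5 (psF ^+ n).
Proof.
have e : (1 : ps) = psC 1.
  by apply: funext => k; rewrite /psC [LHS]/(ps1 k) /ps1; case: eqP.
elim: n => [|n IHn]; last by rewrite !exprS dilM // -IHn.
by rewrite !expr0 e dil_psC.
Qed.

Lemma pr_psGM n f : pr (psG ^+ n * f) = psG ^+ n * pr f.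
Proof. by rewrite psG_exp_dil pr_dilM. Qed.

Lemma pr_N2gen : [/\ pr (N2gen (i5 0)) = 0, pr (N2gen (i5 1)) = psD,
  pr (N2gen (i5 2)) = Dbase 7, pr (N2gen (i5 3)) = Dbase 3 + psG ^+ 2 * psD
  & pr (N2gen (i5 4)) = Dbase 9].
Proof.
rewrite /N2gen /= !inordK //=; split.
- by rewrite psG_dil pr_dil.
- exact: pr_psF.
- by rewrite psD7E psmulC pspowE -[psmul _ _]/(psG ^+ 1 * psF ^+ 2) pr_psGM pr_sqr pr_psF.
- by rewrite pspowE psD3E -addrA psaddrr addr0.
- rewrite psD9E psmulC pspowE -[psmul _ _]/(psG ^+ 1 * psF ^+ (2 * 2)) pr_psGM exprM !pr_sqr.
  by rewrite pr_psF -exprM.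
Qed.

Lemma sum_i5 (f : 'I_5 -> ps) :
  \sum_(i < 5) f i = f (i5 0) + f (i5 1) + f (i5 2) + f (i5 3) + f (i5 4).
Proof.
rewrite !big_ord_recl big_ord0 addr0 !addrA.
by congr (f _ + f _ + f _ + f _ + f _); apply: val_inj; rewrite /= inordK.
Qed.

(** The image of $G^{2M} F^3$ contains $G^{2M+2} D_1 = D_{10(M+1)+1}$, beyond the range of the right
    side; hence the condition on the top coefficient. *)
Lemma pr_N2comb a M : a (i5 3) M = 0 -> pr (N2comb a M.+1) = Dcomb (10 * M.+1) (Dcoef a).
Proof.
move=> a3; rewrite pr_sum Dcomb10.
have [g0 g1 g2 g3 g4] := pr_N2gen.
transitivity (\sum_(j < M.+1) (psG ^+ (2 * j) *
    (psC (a (i5 1) j) * psD + psC (a (i5 3) j) * Dbase 3 +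
     psC (a (i5 2) j) * Dbase 7 + psC (a (i5 4) j) * Dbase 9)) +
   \sum_(j < M.+1) psG ^+ (2 * j) * (psC (a (i5 3) j) * (psG ^+ 2 * psD))).
  rewrite -big_split /=; apply: eq_bigr => j _.
  by rewrite sum_i5 !prD !pr_psC !pr_psGM g0 g1 g2 g3 g4; ring.
rewrite [X in _ + X]big_ord_recr /= a3 psC0 mul0r mulr0 addr0.
(* The extra $G^2$ shifts $j$ to $j + 1$, leaving 0 at $j = 0$. *)
have -> : \sum_(j < M) psG ^+ (2 * j) * (psC (a (i5 3) j) * (psG ^+ 2 * psD)) =
   \sum_(j < M.+1) psG ^+ (2 * j) * (psC (if val j is j'.+1 then a (i5 3) j' else 0) * psD).
  rewrite big_ord_recl /= psC0 mul0r mulr0 add0r; apply: eq_bigr => j _.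
  by rewrite /bump /= add1n mulnS exprD; ring.
rewrite -big_split /=; apply: eq_bigr => j _.
rewrite /Dcoef ![(10 * _)%N]mulnC !divnMDl // !modnMDl /= !addn0 psCD.
by ring.
Qed.

Lemma Dcomb_widen n N c : (n <= N)%N ->
  Dcomb n c = Dcomb N (fun k => if (k < n)%N then c k else 0).
Proof.
move=> nN; rewrite !DcombE (big_ord_widen_cond _ (coprime^~ 10) (fun k => psC (c k) * Dk k) nN).
rewrite big_mkcondr /=; apply: eq_bigr => k _.
by case: ifP => // _; rewrite psC0 mul0r.
Qed.

Lemma Dcomb_eq n c d : (forall k, coprime k 10 -> c k = d k) -> Dcomb n c = Dcomb n d.
Proof. by move=> e; rewrite !DcombE; apply: eq_bigr => k /e->. Qed.

(** Appending a zero row secures the hypothesis of [pr_N2comb]. *)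
Lemma N2comb_pad m a : exists b, N2comb a m = N2comb b m.+1 /\ b (i5 3) m = 0.
Proof.
exists (fun i j => if (j < m)%N then a i j else 0); rewrite ltnn; split=> //.
rewrite /N2comb [RHS]big_ord_recr /= ltnn [X in _ + X]big1 => [|i _].
  by rewrite addr0; apply: eq_bigr => j _; rewrite ltn_ord.
by rewrite psC0 mul0r.
Qed.

Theorem theorem2p7 :
  (* the D_k ((k,10)=1) are linearly independent over Z/2 *)
  (forall (n : nat) (c : nat -> 'F_2),
      Dcomb n c = ps0 -> forall k : nat, (k < n)%N -> coprime k 10 -> c k = 0)
  /\
  (* pr induces a bijection N2/N1 -> W *)
  ((forall x, inN1 x -> pr x = ps0) /\
   (forall x, inN2 x -> inW (pr x)) /\
   (forall x, inN2 x -> pr x = ps0 -> inN1 x) /\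
   (forall w, inW w -> exists x, inN2 x /\ pr x = w)).
Proof.
split; first exact: Dk_free.
split; [|split; [|split]].
- move=> x [m [a ->]]; rewrite [LHS]pr_sum [LHS]big1 // => j _.
  by rewrite psscaleE pr_psC pspowE -[psmul _ _]/(psG ^+ (2 * j) * psG) pr_psGM psG_dil pr_dil !mulr0.
- move=> x /inN2E[m [a ->]]; have [b [-> b3]] := N2comb_pad m a.
  by rewrite pr_N2comb //; exists (10 * m.+1)%N, (Dcoef b).
- move=> x /inN2E[m [a ->]]; have [b [-> b3]] := N2comb_pad m a.
  rewrite pr_N2comb // => /Dk_free c0.
  have c0j j r : (j < m.+1)%N -> (r < 10)%N -> coprime r 10 -> Dcoef b (j * 10 + r) = 0.
    move=> jm r10 cr; apply: c0; first by lia.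
    by rewrite -coprime_modl modnMDl coprime_modl.
  have b2 j : (j < m.+1)%N -> b (i5 2) j = 0.
    by move=> jm; have := c0j j 7%N jm isT isT; rewrite /Dcoef divnMDl // modnMDl /= addn0.
  have b3' j : (j < m.+1)%N -> b (i5 3) j = 0.
    by move=> jm; have := c0j j 3%N jm isT isT; rewrite /Dcoef divnMDl // modnMDl /= addn0.
  have b4 j : (j < m.+1)%N -> b (i5 4) j = 0.
    by move=> jm; have := c0j j 9%N jm isT isT; rewrite /Dcoef divnMDl // modnMDl /= addn0.
  (* The coefficient of $D_{10j+1}$ also contains the $F^3$ coefficient of row $j - 1$, already
     known to vanish. *)
  have b1 j : (j < m.+1)%N -> b (i5 1) j = 0.
    move=> jm; have := c0j j 1%N jm isT isT; rewrite /Dcoef divnMDl // modnMDl /= addn0.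
    by case: j jm => [|j] jm; rewrite ?b3' ?addr0 //; apply: ltnW.
  exists m.+1, (b (i5 0)); apply: eq_bigr => j _; rewrite sum_i5.
  rewrite b1 // b2 // b3' // b4 // psC0 !mul0r !addr0 psscaleE pspowE.
  by rewrite /N2gen /= inordK.
- move=> w [n [c ->]].
  (* Rows $0, \dots, n$ suffice, and row $n$ has zero $F^3$ coefficient because $10 n + 3 \ge n$. *)
  have nN : (n <= 10 * n.+1)%N by lia.
  rewrite (Dcomb_widen _ nN); pose d k := if (k < n)%N then c k else 0; rewrite -/d.
  (* This inverts [Dcoef]: the $F$ coefficient is corrected by the $D_1$ term coming from $F^3$ one
     row below. *)
  pose a (i : 'I_5) (j : nat) : 'F_2 := match val i with
    | 1 => d (j * 10 + 1)%N - (if j is j'.+1 then d (j' * 10 + 3)%N else 0)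
    | 2 => d (j * 10 + 7)%N
    | 3 => d (j * 10 + 3)%N
    | 4 => d (j * 10 + 9)%N
    | _ => 0 end.
  exists (N2comb a n.+1); split; first by apply/inN2E; exists n.+1, a.
  rewrite pr_N2comb; last by rewrite /a /= inordK // /d ifF //; lia.
  apply: Dcomb_eq => k ck; rewrite [in RHS](divn_eq k 10) /Dcoef /a /= !inordK //.
  move: ck; rewrite -coprime_modl; have := ltn_pmod k (isT : (0 < 10)%N).
  case: (k %% 10)%N => [|[|[|[|[|[|[|[|[|[|//]]]]]]]]]] // _ _.
  by rewrite subrK.
Qed.
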